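(* Consider the tokenized multi-armed bandit (TMAB) problem with horizon $T\ge2$, token set of size $n$, and maximal depth $L$. Suppose the utility function $u$ is monotone, has small single-level deviation, and satisfies DDMC$'$ (all defined in the context). Then, for a suitable choice of its exploration parameter $N$, the algorithm GreedyETC achieves expected regret $$\mathrm{Reg}=O\big(nL\,T^{2/3}(\log T)^{1/3}\big).$$ (The noise bound $\sigma$, the range of $u$, and the constant in the small single-level deviation assumption are treated as constants absorbed in $O(\cdot)$.)
   Context: **Sequences.** $\mathcal V$ is a finite token set, $|\mathcal V|=n$, containing a special token $\mathrm{EOS}$. For a finite token sequence $\mathbf y$, $|\mathbf y|$ is its length, $\mathbf y^{(1:j)}$ its prefix of length $j$, and $\mathbf y:\mathbf z$ denotes concatenation. A sequence is complete if its last token is $\mathrm{EOS}$. Algorithms output only complete sequences of length at most $L$ ($L$ is known). **TMAB problem.** There is an unknown utility function $u$ from finite token sequences to $\mathbb R_{\ge0}$, the same in all rounds (the query is fixed and suppressed). In each round $t\in[T]$ the decision maker irrevocably chooses tokens one by one to build a complete sequence $\mathbf y_t$ with $|\mathbf y_t|\le L$ and then observes only the reward $r_t(\mathbf y_t)=u(\mathbf y_t)+\eta_t$, where $\eta_t$ is independent zero-mean noise with $|\eta_t|\le\sigma$. The regret is $\mathrm{Reg}=T\max_{\mathbf z}u(\mathbf z)-\sum_{t=1}^T\mathbb E[u(\mathbf y_t)]$, the maximum over complete sequences of length at most $L$. **Monotone.** (i) Appending further $\mathrm{EOS}$ tokens to a sequence ending in $\mathrm{EOS}$ does not change the utility; (ii)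 appending a non-$\mathrm{EOS}$ token to a sequence ending in $\mathrm{EOS}$ can only decrease the utility. **Small single-level deviation (SSLD).** Let $\mathbf o$ be the optimal complete sequence. For any sequence $\mathbf a$ that deviates from $\mathbf o$ for the first time at level $i$, $|u(\mathbf o^{(1:i)})-u(\mathbf a^{(1:i)})|\le\varepsilon$, with $\varepsilon=O(1/\sqrt T)$. **DDMC$'$.** For any two different finite sequences $\mathbf y,\mathbf z$ with $|\mathbf y|=|\mathbf z|$ and any token $\tau\in\mathcal V$: $|u(\mathbf y:\tau:\mathrm{EOS})-u(\mathbf z:\tau:\mathrm{EOS})|\le|u(\mathbf y:\mathrm{EOS})-u(\mathbf z:\mathrm{EOS})|$. **GreedyETC (parameter $N$).** Start with the empty sequence $\mathbf y$. For $k=1,\dots,L$: if $|\mathbf y|=L-1$, replace $\mathbf y$ by $\mathbf y:\mathrm{EOS}$ and exit the loop. Otherwise, for each token $\tau\in\mathcal V$ submit $\mathbf y:\tau:\mathrm{EOS}$ in $N$ rounds and let $\bar r(\mathbf y:\tau)$ be the average observed reward; let $\tau^*\in\arg\max_{\tau\in\mathcal V}\bar r(\mathbf y:\tau)$, replace $\mathbf y$ by $\mathbf y:\tau^*$, and exit the loop if $\tau^*=\mathrm{EOS}$. In all remaining rounds submit $\mathbf y$.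
   Formalization: Small single-level deviation is required for completed prefixes, |u(o^(1:i):EOS) - u(a^(1:i):EOS)| ≤ ε, instead of the raw prefixes o^(1:i), a^(1:i); with raw prefixes the claim is false, since the utility of an incomplete prefix is not tied to that of its completion. *)

(* Defs.v *)
From mathcomp Require Export all_boot all_order all_algebra.
From mathcomp Require Export all_classical all_reals all_analysis.

Set Implicit Arguments.
Unset Strict Implicit.
Unset Printing Implicit Defensive.

Import Order.TTheory GRing.Theory Num.Theory.

Local Open Scope classical_set_scope.
Local Open Scope ring_scope.

(* Token sequences and utility functions.  Levels are 0-based: level i below
   is level i+1 of the usual 1-based numbering, and take i y is the prefix of
   length i. *)

Definition complete_seq (V : finType) (EOS : V) (y : seq V) : bool :=
  if y is x :: s then last x s == EOS else false.

Definition monotone_utility (R : realType) (V : finType) (EOS : V)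
    (u : seq V -> R) : Prop :=
  (forall (y : seq V) (k : nat), complete_seq EOS y -> u (y ++ nseq k EOS) = u y) /\
  (forall (y : seq V) (tau : V), complete_seq EOS y -> tau != EOS ->
     u (rcons y tau) <= u y).

Definition ddmc' (R : realType) (V : finType) (EOS : V) (u : seq V -> R) : Prop :=
  forall (y z : seq V) (tau : V), y != z -> size y = size z ->
    `|u (y ++ [:: tau; EOS]) - u (z ++ [:: tau; EOS])|
      <= `|u (y ++ [:: EOS]) - u (z ++ [:: EOS])|.

Definition optimal (R : realType) (V : finType) (EOS : V) (L : nat)
    (u : seq V -> R) (o : seq V) : Prop :=
  [/\ complete_seq EOS o, (size o <= L)%N &
      forall z : seq V, complete_seq EOS z -> (size z <= L)%N -> u z <= u o].

Definition deviates_at (V : finType) (EOS : V) (o a : seq V) (i : nat) : Prop :=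
  [/\ (i < size o)%N, (i < size a)%N, take i a = take i o &
      nth EOS a i <> nth EOS o i].

(* Only complete sequences are ever submitted and rewarded, so the utility of a
   prefix y is read as that of its completion y : EOS, as in ddmc'.  For a
   prefix that is already complete this is the utility of y itself, by the
   first part of monotone_utility. *)
Definition ssld (R : realType) (V : finType) (EOS : V) (u : seq V -> R)
    (o : seq V) (eps : R) : Prop :=
  forall (a : seq V) (i : nat), deviates_at EOS o a i ->
    `|u (take i.+1 o ++ [:: EOS]) - u (take i.+1 a ++ [:: EOS])| <= eps.

(* A deterministic policy maps the rewards observed so far to the next
   submission.  The past submissions are determined by the past rewards, so
   they need not be recorded in the history. *)
Definition policy (R : realType) (V : finType) := seq R -> seq V.

Fixpoint rewards (R : realType) (V : finType) (pi : policy R V)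
    (u : seq V -> R) (eta : nat -> R) (t : nat) : seq R :=
  if t is s.+1 then
    let h := rewards pi u eta s in rcons h (u (pi h) + eta s)
  else [::].

Definition submitted (R : realType) (V : finType) (pi : policy R V)
    (u : seq V -> R) (eta : nat -> R) (t : nat) : seq V :=
  pi (rewards pi u eta t).

(* Level k of the exploration occupies the rounds k * n * N, ..., (k+1) * n * N - 1
   with n = #|V|, split into n blocks of N rounds, one for each token in the
   order of enum V. *)
Definition avg_reward (R : realType) (V : finType) (N : nat) (h : seq R)
    (k : nat) (tau : V) : R :=
  (\sum_(j < N) nth 0 h ((k * #|V| + index tau (enum V)) * N + j)) / N%:R.

Definition argmax_tokens (R : realType) (V : finType) (f : V -> R) : {set V} :=
  [set tau | [forall tau', f tau' <= f tau]]%SET.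

Definition tie_breaking (V : finType) (tie : seq V -> {set V} -> V) : Prop :=
  forall (y : seq V) (S : {set V}), S != finset.set0 -> tie y S \in S.

(* The sequence built after k iterations of the loop; once it is complete the
   loop has been exited. *)
Fixpoint greedy_prefix (R : realType) (V : finType) (EOS : V)
    (tie : seq V -> {set V} -> V) (L N : nat) (h : seq R) (k : nat) : seq V :=
  if k is k'.+1 then
    let y := greedy_prefix EOS tie L N h k' in
    if complete_seq EOS y then y
    else if size y == L.-1 then rcons y EOS
    else rcons y (tie y (argmax_tokens (avg_reward N h k')))
  else [::].

Definition greedyETC (R : realType) (V : finType) (EOS : V)
    (tie : seq V -> {set V} -> V) (L N : nat) : policy R V := fun h =>
  let y := greedy_prefix EOS tie L N h (size h %/ (#|V| * N)) in
  if complete_seq EOS y then y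
  else if size y == L.-1 then rcons y EOS
  else y ++ [:: nth EOS (enum V) ((size h %/ N) %% #|V|); EOS].

Definition mutually_independent (d : measure_display) (Omega : measurableType d)
    (R : realType) (P : probability Omega R) (I : finType)
    (X : I -> {RV P >-> R}) : Prop :=
  forall (J : {set I}) (A : I -> set R), (forall i, measurable (A i)) ->
    P (\bigcap_(i in [set` J]) (X i @^-1` A i)) =
      (\prod_(i in J) P (X i @^-1` A i))%E.

Definition noise (d : measure_display) (Omega : measurableType d)
    (R : realType) (P : probability Omega R) (T : nat) (sigma : R)
    (eta : nat -> {RV P >-> R}) : Prop :=
  [/\ mutually_independent (fun t : 'I_T => eta t),
      forall t, (t < T)%N -> ('E_P[eta t] = 0)%E &
      forall t w, (t < T)%N -> `|eta t w| <= sigma].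

(* The maximum is over the finite type of sequences of length at most L; the
   default value 0 is harmless since utilities are nonnegative. *)
Definition max_utility (R : realType) (V : finType) (EOS : V) (L : nat)
    (u : seq V -> R) : R :=
  \big[Num.max/0]_(z : L.-bseq V | complete_seq EOS z) u z.

Definition regret (d : measure_display) (Omega : measurableType d)
    (R : realType) (P : probability Omega R) (V : finType) (EOS : V)
    (T L : nat) (u : seq V -> R) (eta : nat -> {RV P >-> R})
    (pi : policy R V) : \bar R :=
  ((T%:R * max_utility EOS L u)%:E
   - \sum_(t < T) 'E_P[fun w => u (submitted pi u (fun s => eta s w) t)])%E.

(* Main.v *)
From HB Require Import structures.
Require Import Defs.
From mathcomp Require Import ring lra measurable_realfun.

Import Order.TTheory GRing.Theory Num.Theory.

Local Open Scope ring_scope.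

Set Implicit Arguments.
Unset Strict Implicit.
Unset Printing Implicit Defensive.

(** By SSLD and DDMC', induction on the length shows that every sequence y of
    length j <= |o| satisfies |u(y:EOS) - u(o^(1:j):EOS)| <= j eps.  So whatever greedy has
    chosen when it reaches the level of o, it has lost at most L eps, and an early
    EOS is covered by padding with further EOS tokens.  Beyond the level of o, EOS is
    always an available token that keeps the utility unchanged, so each further
    greedy choice costs at most twice the averaging errors M of its level.  No
    concentration inequality is needed: with q = T^(1/3) one has |M| <= q M^2 + 1/q,
    pairwise independence gives E[M^2] <= sigma^2 / N, and N of order q^2 makes
    exploration and exploitation both cost O(n L q^2); the logarithmic factor of the
    bound is only used through ln T >= ln 2.  When the exploration does not fit in
    the horizon, the regret is at most T B, which the cost of exploration covers. *)

(** * Deterministic loss of sequences compared with the optimum *)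

Section TokenSequences.
Context (R : realType) (V : finType) (EOS : V) (L : nat).
Context (u : seq V -> R) (o : seq V) (eps : R).
Hypotheses (mono_u : monotone_utility EOS u) (opt_o : optimal EOS L u o).
Hypotheses (eps_ge0 : 0 <= eps) (ssld_u : ssld EOS u o eps) (ddmc_u : ddmc' EOS u).

Lemma complete_rcons (y : seq V) (t : V) : complete_seq EOS (rcons y t) = (t == EOS).
Proof. by case: y => [|x y] //=; rewrite last_rcons. Qed.

Lemma complete_cat_EOS (y : seq V) : complete_seq EOS (y ++ [:: EOS]).
Proof. by rewrite cats1 complete_rcons. Qed.

Lemma utility_cat_EOS (y : seq V) : complete_seq EOS y -> u (y ++ [:: EOS]) = u y.
Proof. by move=> cy; rewrite -(mono_u.1 _ 1%N cy). Qed.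

(** Induction on the last token [t]. If [y] is still a prefix of [o], SSLD alone pays one [eps].
    Otherwise DDMC' moves from [y] to the prefix of [o] under the common token [t] at no more than
    the earlier loss, and SSLD then exchanges [t] for the token of [o]. *)
Lemma deviation_bound (y : seq V) : (size y <= size o)%N ->
  `|u (y ++ [:: EOS]) - u (take (size y) o ++ [:: EOS])| <= (size y)%:R * eps.
Proof.
elim/last_ind: y => [|y t IH]; first by rewrite take0 subrr normr0 mul0r.
rewrite size_rcons => yo.
have stepo : take (size y).+1 o = rcons (take (size y) o) (nth EOS o (size y)).
  by rewrite (take_nth EOS).
have szo : size (take (size y) o) = size y by rewrite size_takel // ltnW.
(* Changing only the last token of a prefix of [o] is a first deviation at that level, unless [s] is
   the token of [o] itself. *)
have dev (s : V) : `|u (take (size y) o ++ [:: s; EOS])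
                 - u (take (size y).+1 o ++ [:: EOS])| <= eps.
  rewrite stepo cat_rcons; have [->|so] := eqVneq s (nth EOS o (size y)).
    by rewrite subrr normr0.
  have : deviates_at EOS o (rcons (take (size y) o) s) (size y).
    split=> //; rewrite ?size_rcons ?szo //.
      by rewrite -cats1 take_size_cat.
    by rewrite nth_rcons szo ltnn eqxx; apply/eqP.
  move/ssld_u; rewrite [take _ (rcons _ _)]take_oversize ?size_rcons ?szo //.
  by rewrite stepo !cat_rcons distrC.
rewrite cat_rcons; have [yE|yN] := eqVneq y (take (size y) o).
  rewrite {1}yE (le_trans (dev t)) //.
  by rewrite mulrS mulrDl mul1r lerDl mulr_ge0.
have := ddmc_u t yN (esym szo).
have := IH (ltnW yo); have := dev t.
have := ler_distD (u (take (size y) o ++ [:: t; EOS]))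
  (u (y ++ [:: t; EOS])) (u (take (size y).+1 o ++ [:: EOS])).
rewrite -natr1; lra.
Qed.

Lemma utility_same_length (y : seq V) : size y = size o ->
  u o - (size o)%:R * eps <= u (y ++ [:: EOS]).
Proof.
move=> yo; have [co _ _] := opt_o; have := @deviation_bound y.
rewrite yo leqnn take_size (utility_cat_EOS co) => /(_ isT).
by rewrite ler_norml lerBlDl lerBlDr addrC => /andP[+ _]; lra.
Qed.

(* Padding with EOS reduces to the case of equal lengths. *)
Lemma utility_complete_short (y : seq V) : complete_seq EOS y -> (size y <= size o)%N ->
  u o - (size o)%:R * eps <= u y.
Proof.
move=> cy yo; rewrite -(mono_u.1 _ (size o - size y).+1 cy) -addn1 nseqD catA.
by apply: utility_same_length; rewrite size_cat size_nseq subnKC.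
Qed.

(** * The greedy prefix for a fixed reward history *)

Section Greedy.
Context (tie : seq V -> {set V} -> V) (N : nat) (h : seq R) (M : nat -> V -> R).
Hypotheses (tieP : tie_breaking tie).

Let p := greedy_prefix EOS tie L N h.

(* [M k tau] is the average noise over the block of level [k] and token [tau]. *)
Hypothesis avgE : forall k tau, (k < L)%N -> ~~ complete_seq EOS (p k) ->
  size (p k) != L.-1 -> avg_reward N h k tau = u (p k ++ [:: tau; EOS]) + M k tau.

Lemma greedy_prefix_size k : complete_seq EOS (p k) \/ size (p k) = k.
Proof.
elim: k => [|k IH]; first by right.
rewrite /p /= -/(p k); case: ifPn => [|cp]; first by left.
have {IH} [/(negP cp)//|pk] := IH.
by case: ifP => _; right; rewrite size_rcons pk.
Qed.

Lemma greedy_prefix_stable k m : complete_seq EOS (p k) -> (k <= m)%N -> p m = p k.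
Proof.
move=> cp; elim: m => [|m IH]; first by rewrite leqn0 => /eqP->.
rewrite leq_eqVlt => /predU1P[->//|/IH E].
by rewrite /p /= -/(p m) E cp.
Qed.

(** A prefix still incomplete before the last iteration has length [L.-1], and there EOS is
    forced. *)
Lemma greedy_prefix_complete : (0 < L)%N -> complete_seq EOS (p L).
Proof.
move=> L0; have -> : p L = p L.-1.+1 by rewrite prednK.
rewrite /p /= -/(p L.-1); case: ifPn => // cp.
have [/(negP cp)//|->] := greedy_prefix_size L.-1.
by rewrite eqxx complete_rcons.
Qed.

Lemma argmax_tokens_neq0 (f : V -> R) : argmax_tokens f != finset.set0.
Proof.
apply/set0Pn; exists [arg max_(i > EOS) f i]%O; rewrite finset.inE.
by apply/forallP => j; case: arg_maxP => // i _; apply.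
Qed.

(** EOS is among the compared tokens, and a doubled EOS has the utility of a single one. The winner
    has at least the average of EOS; the factor 2 counts the errors of these two averages, each at
    most the sum over all tokens. *)
Lemma greedy_step k : (k < L)%N ->
  u (p k ++ [:: EOS]) - 2 * \sum_(tau : V) `|M k tau| <= u (p k.+1 ++ [:: EOS]).
Proof.
move=> kL; have M0 : 0 <= \sum_(tau : V) `|M k tau| by apply: sumr_ge0.
rewrite /p /= -/(p k); case: ifPn => cp; first by lra.
case: ifPn => sp.
  by rewrite -[rcons _ _]cats1 [leRHS]utility_cat_EOS ?complete_cat_EOS //; lra.
set t := tie _ _; have := tieP (p k) (argmax_tokens_neq0 (avg_reward N h k)).
rewrite -/t finset.inE => /forallP/(_ EOS); rewrite !avgE // cat_rcons.
have := utility_cat_EOS (complete_cat_EOS (p k)); rewrite -catA /= => ->.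
have MS tau : `|M k tau| <= \sum_(tau : V) `|M k tau|.
  by rewrite (bigD1 tau) //= lerDl sumr_ge0.
have := MS t; have := MS EOS.
by rewrite !ler_norml => /andP[? ?] /andP[? ?]; lra.
Qed.

(** The side condition holds once greedy has stopped or reached the length of [o]. While the prefix
    is no longer than [o], the length comparisons bound it without any averaging error; from then on
    [greedy_step] adds the error of each level. *)
Lemma greedy_prefix_bound k : (k <= L)%N -> complete_seq EOS (p k) \/ (size o <= k)%N ->
  u o - (size o)%:R * eps - 2 * \sum_(k' < k) \sum_(tau : V) `|M k' tau|
    <= u (p k ++ [:: EOS]).
Proof.
have short m : complete_seq EOS (p m) \/ (size o <= m)%N -> (size (p m) <= size o)%N ->
    u o - (size o)%:R * eps <= u (p m ++ [:: EOS]).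
  move=> cm pm; case: (boolP (complete_seq EOS (p m))) => [c|nc].
    by rewrite utility_cat_EOS // utility_complete_short.
  case: cm => [/(negP nc)//|om]; apply: utility_same_length.
  have [/(negP nc)//|pE] := greedy_prefix_size m.
  by apply/eqP; rewrite eqn_leq pm pE.
have sum0 m : 0 <= \sum_(k' < m) \sum_(tau : V) `|M k' tau|.
  by apply: sumr_ge0 => ? _; apply: sumr_ge0.
elim: k => [|k IH] kL co.
  by rewrite big_ord0 mulr0 subr0; apply: short.
have [pk|pk] := leqP (size (p k.+1)) (size o).
  by apply: le_trans (short _ co pk); have := sum0 k.+1; lra.
(* One iteration appends at most one token, so a prefix now longer than [o] met the side condition
   one level earlier. *)
have ck : complete_seq EOS (p k) \/ (size o <= k)%N.
  have [|szk] := greedy_prefix_size k; [by left|].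
  case: (boolP (complete_seq EOS (p k))) => [|nc]; first by left.
  right; move: pk; rewrite /p /= -/(p k) (negbTE nc).
  by case: ifP => _; rewrite size_rcons szk ltnS.
have := greedy_step kL; have := IH (ltnW kL) ck.
by rewrite big_ord_recr /=; lra.
Qed.

End Greedy.

End TokenSequences.


(** * Integrals, independence and second moments *)

Lemma le_integral_ge0 d (T : measurableType d) (R : realType) (mu : {measure set T -> \bar R})
    (f g : T -> \bar R) : mu.-integrable setT g -> (forall x, 0 <= f x)%E ->
  (forall x, g x <= f x)%E -> (\int[mu]_x g x <= \int[mu]_x f x)%E.
Proof.
move=> ig f0 gf.
have mg : measurable_fun [set: T]%classic g by exact: (measurable_int mu ig).
apply: (@le_trans _ _ (\int[mu]_x funepos g x)%E).
  apply: le_integral => //; first exact: integrable_funepos.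
  by move=> x _; rewrite funeposE le_max lexx.
(* Both integrals are suprema over simple functions below the integrand, and any such function below
   the positive part of [g] is also below [f]. *)
rewrite !ge0_integralTE //.
apply: ereal_sup_le => _ [h hg <-]; exists h => //= x.
by apply: le_trans (hg x) _; rewrite funeposE ge_max gf f0.
Qed.

Section Independence.
Context d (T : measurableType d) (R : realType) (P : probability T R).
Context (X Y : {RV P >-> R}).
Hypothesis indXY : forall A B : set R, measurable A -> measurable B ->
  (P ((X @^-1` A) `&` (Y @^-1` B)) = P (X @^-1` A) * P (Y @^-1` B))%E%classic.
Hypotheses (iX : P.-integrable [set: T] (EFin \o X))
  (iY : P.-integrable [set: T] (EFin \o Y))
  (iXY : P.-integrable [set: T] (EFin \o (fun w => X w * Y w))).

(** Independence makes the joint law of [X] and [Y] the product of their laws, and Fubini factors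
    the integral of the product. *)
Lemma expectation_mul_independent : ('E_P[fun w => (X w * Y w)%R] = 'E_P[X] * 'E_P[Y])%E.
Proof.
pose W w := (X w, Y w).
have mW : measurable_fun [set: T] W by apply: measurable_fun_pair.
pose f (z : R * R) := (z.1 * z.2)%:E.
have mf : measurable_fun [set: R * R] f.
  by apply/measurable_EFinP; apply: measurable_funM; [exact: measurable_fst|exact: measurable_snd].
pose mX := distribution P X; pose mY := distribution P Y.
pose WP := isMeasurableFun.Build _ _ _ _ _ mW.
pose WM : {mfun T >-> (R * R)%type} := HB.pack W WP.
(* The product measure is determined by rectangles, where the equality is independence. *)
have prodE A : measurable A -> (mX \x mY)%E A = distribution P WM A.
  by apply: product_measure_unique => A1 A2 mA1 mA2; rewrite -indXY.
have ifW : (distribution P WM).-integrable [set: R * R] f.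
  by apply: integrable_pushforward.
have ifp : (mX \x mY)%E.-integrable [set: R * R] f.
  move/integrableP : ifW => [_ ?]; apply/integrableP; split => //.
  by rewrite (@eq_measure_integral _ _ _ _ (distribution P WM)) // => A mA _; exact: prodE.
have -> : ('E_P[fun w => (X w * Y w)%R] = \int[distribution P WM]_z f z)%E.
  by rewrite unlock integral_distribution.
rewrite -(@eq_measure_integral _ _ _ _ _ (mX \x mY)%E) => [|A mA _]; last exact: prodE.
rewrite -integral12_prod_meas1 // /fubini_F.
have intY : (\int[mY]_y y%:E = 'E_P[Y])%E.
  by rewrite unlock integral_distribution.
have ifY : mY.-integrable [set: R] EFin by apply: integrable_pushforward.
have ifX : mX.-integrable [set: R] EFin by apply: integrable_pushforward.
have finY : ('E_P[Y] \is a fin_num)%E.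
  by rewrite -intY; apply: integrable_fin_num.
have inner x : (\int[mY]_y f (x, y) = x%:E * 'E_P[Y])%E.
  by rewrite /f /= -intY -integralZl.
under eq_integral do rewrite inner.
rewrite -(fineK finY) integralZr //.
by congr (_ * _)%E; rewrite unlock integral_distribution.
Qed.

End Independence.

Section BoundedVariables.
Context d (T : measurableType d) (R : realType) (P : probability T R).

Lemma bounded_integrable (f : T -> R) (b : R) : measurable_fun [set: T] f ->
  (forall w, `|f w| <= b) -> P.-integrable [set: T] (EFin \o f).
Proof.
move=> mf fb; apply: measurable_bounded_integrable => //.
  by rewrite ltey_eq fin_num_measure.
exists b; split; first exact: num_real.
by move=> M bM w _ /=; apply: le_trans (fb w) (ltW bM).
Qed.

Lemma expectation_fin_sum (I : finType) (f : I -> T -> R) :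
  (forall i, P.-integrable [set: T] (EFin \o f i)) ->
  ('E_P[fun w => (\sum_i f i w)%R] = \sum_i 'E_P[f i])%E.
Proof.
move=> fi; rewrite unlock; under eq_integral do rewrite -sumEFin.
by rewrite integral_sum.
Qed.

Lemma integrable_fin_sum (I : finType) (f : I -> T -> R) :
  (forall i, P.-integrable [set: T] (EFin \o f i)) ->
  P.-integrable [set: T] (EFin \o (fun w => \sum_i f i w)).
Proof.
move=> fi; have -> : EFin \o (fun w => \sum_i f i w) =
    (fun w => \sum_i (EFin \o f i) w)%E.
  by apply/funext => w /=; rewrite sumEFin.
by apply: integrable_sum => // i _; exact: fi.
Qed.

(** In the expanded square the off-diagonal terms have mean zero, leaving [N] diagonal terms of at
    most [sigma ^+ 2] against the divisor [N ^ 2]. *)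
Lemma expectation_sqr_mean N (X : 'I_N -> {RV P >-> R}) (sigma : R) : (0 < N)%N ->
  (forall i j (A B : set R), i != j -> measurable A -> measurable B ->
    P ((X i @^-1` A) `&` (X j @^-1` B)) = P (X i @^-1` A) * P (X j @^-1` B))%E%classic ->
  (forall i, 'E_P[X i] = 0)%E -> (forall i w, `|X i w| <= sigma) ->
  ('E_P[fun w => (((\sum_i X i w) / N%:R) ^+ 2)%R] <= (sigma ^+ 2 / N%:R)%:E)%E.
Proof.
move=> N0 indX EX0 Xs.
have mX i j : measurable_fun [set: T] (fun w => X i w * X j w).
  exact: measurable_funM.
have bX i j w : `|X i w * X j w| <= sigma ^+ 2.
  by rewrite normrM expr2 ler_pM.
have iXX i j : P.-integrable [set: T] (EFin \o (fun w => X i w * X j w)).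
  exact: bounded_integrable (bX i j).
have iX i : P.-integrable [set: T] (EFin \o X i).
  exact: bounded_integrable (Xs i).
have iS i : P.-integrable [set: T] (EFin \o (fun w => \sum_j X i w * X j w)).
  exact: integrable_fin_sum.
have cross i j : i != j -> ('E_P[fun w => (X i w * X j w)%R] = 0)%E.
  move=> ij; rewrite expectation_mul_independent ?EX0 ?mule0 // => A B.
  exact: indX.
have diag i : ('E_P[fun w => (X i w * X i w)%R] <= (sigma ^+ 2)%:E)%E.
  have -> : ((sigma ^+ 2)%:E = 'E_P[cst (sigma ^+ 2)%R])%E by rewrite expectation_cst.
  rewrite unlock; apply: le_integral => //.
  - exact: iXX.
  - exact: finite_measure_integrable_cst.
  - by move=> w _; rewrite lee_fin (le_trans (ler_norm _)).
have sqE w : ((\sum_i X i w) / N%:R) ^+ 2 =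
    N%:R ^- 2 * \sum_i \sum_j X i w * X j w.
  rewrite exprMn exprVn mulrC; congr (_ * _); rewrite expr2 big_distrl /=.
  by apply: eq_bigr => i _; rewrite big_distrr.
have -> : (fun w => ((\sum_i X i w) / N%:R) ^+ 2) =
    N%:R ^- 2 \o* (fun w => \sum_i \sum_j X i w * X j w).
  by apply/funext => w; rewrite sqE /= mulrC.
rewrite expectationZl; last first.
  by apply/Lfun1_integrable; exact: integrable_fin_sum.
rewrite expectation_fin_sum //.
have -> : (sigma ^+ 2 / N%:R)%:E = ((N%:R ^- 2)%:E * \sum_(i < N) (sigma ^+ 2)%:E)%E.
  rewrite sumEFin -EFinM sumr_const card_ord -mulr_natr; congr EFin.
  by field; rewrite pnatr_eq0 -lt0n.
apply: lee_wpmul2l; first by rewrite lee_fin invr_ge0 exprn_ge0.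
apply: lee_sum => i _; rewrite expectation_fin_sum; last by move=> j; exact: iXX.
rewrite (bigD1 i) //= big1 ?adde0 // => j; rewrite eq_sym; exact: cross.
Qed.

End BoundedVariables.

(** * Rounds, blocks and the behaviour of the policy *)

Section Policy.
Context (R : realType) (V : finType) (EOS : V) (L N : nat).
Context (u : seq V -> R) (tie : seq V -> {set V} -> V) (e : nat -> R).
Hypothesis (N_gt0 : (0 < N)%N).

Let n := #|V|.
Let pi := greedyETC EOS tie L N : policy R V.
Let h := rewards pi u e.
Let p t := greedy_prefix EOS tie L N (h t).

Definition avg_noise k (tau : V) : R :=
  (\sum_(j < N) e ((k * #|V| + index tau (enum V)) * N + j)) / N%:R.

Lemma size_rewards t : size (h t) = t.
Proof. by elim: t => //= t IH; rewrite size_rcons IH. Qed.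

Lemma nth_rewards t s : (s < t)%N -> nth 0 (h t) s = u (pi (h s)) + e s.
Proof.
elim: t => //= t IH; rewrite nth_rcons size_rewards ltnS leq_eqVlt.
by case: ltngtP => //= [st _|-> _]; first exact: IH.
Qed.

Lemma card_token_gt0 : (0 < n)%N.
Proof. by apply/card_gt0P; exists EOS. Qed.

(** Matches the round numbers used in [avg_reward] with the divisions by which [greedyETC] recovers
    level and token from the length of the history. *)
Lemma token_round (k j : nat) (tau : V) : (j < N)%N ->
  let s := ((k * n + index tau (enum V)) * N + j)%N in
  [/\ (s %/ (n * N) = k)%N, (s %/ N %% n = index tau (enum V))%N,
      (k * n * N <= s)%N & (s < k.+1 * n * N)%N].
Proof.
move=> jN s; have it : (index tau (enum V) < n)%N.
  by rewrite /n cardE index_mem mem_enum.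
have sN : (s %/ N = k * n + index tau (enum V))%N.
  by rewrite divnMDl // (divn_small jN) addn0.
split.
- by rewrite mulnC divnMA sN divnMDl ?card_token_gt0 // divn_small ?addn0.
- by rewrite sN modnMDl modn_small.
- by rewrite /s mulnDl -addnA leq_addr.
- rewrite /s mulSn; apply: (@leq_trans ((k * n + index tau (enum V)).+1 * N)).
    by rewrite mulSn addnC ltn_add2r.
  by rewrite leq_pmul2r // addnC ltn_add2r.
Qed.

(** The first [k] choices read only the rewards of the first [k] levels, which later rounds do not
    alter. Hence the prefix tested during level [k] is the one seen in hindsight. *)
Lemma greedy_prefix_eq (t t' k : nat) : (k * n * N <= t)%N -> (k * n * N <= t')%N ->
  p t k = p t' k.
Proof.
elim: k => // k IH kt kt'.
have kk : (k * n * N <= k.+1 * n * N)%N by rewrite leq_mul2r leq_mul2r leqnSn !orbT.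
rewrite /p /= -/(p t k) -/(p t' k) (IH (leq_trans kk kt) (leq_trans kk kt')).
suff -> : avg_reward (V := V) N (h t) k = avg_reward N (h t') k by [].
apply/funext => tau; congr (_ / _); apply: eq_bigr => j _.
have [_ _ _ sk] := token_round k tau (ltn_ord j).
by rewrite !nth_rewards //; apply: leq_trans sk _.
Qed.

Lemma avg_rewardE t k tau : (L * n * N <= t)%N -> (k < L)%N ->
  ~~ complete_seq EOS (p t k) -> size (p t k) != L.-1 ->
  avg_reward N (h t) k tau = u (p t k ++ [:: tau; EOS]) + avg_noise k tau.
Proof.
move=> Lt kL cp sp.
have N0 : N%:R != 0 :> R by rewrite pnatr_eq0 -lt0n.
have kkt : (k.+1 * n * N <= t)%N.
  by apply: leq_trans Lt; rewrite !leq_mul2r kL !orbT.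
have kt : (k * n * N <= t)%N.
  by apply: leq_trans kkt; rewrite !leq_mul2r leqnSn !orbT.
rewrite /avg_reward; under eq_bigr => j _.
  have [sk si ks sk1] := token_round k tau (ltn_ord j).
  rewrite nth_rewards; last exact: leq_trans sk1 kkt.
  rewrite {1}/pi /greedyETC size_rewards -/n sk si.
  rewrite -/(p _ _) (greedy_prefix_eq ks kt) (negbTE cp) (negbTE sp).
  rewrite nth_index ?mem_enum //.
  over.
by rewrite big_split /= sumr_const card_ord mulrDl -(mulr_natr (u _)) mulfK.
Qed.

Lemma exploitation_bound t o eps : (0 < L)%N -> (L * n * N <= t)%N ->
  monotone_utility EOS u -> optimal EOS L u o -> 0 <= eps -> ssld EOS u o eps ->
  ddmc' EOS u -> tie_breaking tie ->
  u o - L%:R * eps - 2 * \sum_(k < L) \sum_(tau : V) `|avg_noise k tau|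
    <= u (submitted pi u e t).
Proof.
move=> L0 Lt mono opt eps0 ssld_o ddmc tieP.
have cL : complete_seq EOS (p t L) by exact: greedy_prefix_complete.
have -> : submitted pi u e t = p t L.
  rewrite /submitted /pi /greedyETC -/pi -/h size_rewards -/n.
  (* In late rounds the iteration count read off the history may exceed [L]; the complete prefix no
     longer changes. *)
  have Lk : (L <= t %/ (n * N))%N.
    by rewrite leq_divRL ?muln_gt0 ?card_token_gt0 // mulnA.
  by rewrite (greedy_prefix_stable cL Lk) -/(p t L) cL.
have avgE k tau := @avg_rewardE t k tau Lt.
have [_ oL _] := opt.
have := greedy_prefix_bound mono opt eps0 ssld_o ddmc tieP avgE (leqnn L) (or_introl cL).
rewrite (utility_cat_EOS mono cL); apply: le_trans.
by rewrite !lerB // ler_wpM2r // ler_nat.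
Qed.

End Policy.


(** * Expected regret for a given block length *)

Section Regret.
Context (R : realType) (V : finType) (EOS : V) (L N T : nat).
Context (d : measure_display) (Omega : measurableType d) (P : probability Omega R).
Context (u : seq V -> R) (o : seq V) (tie : seq V -> {set V} -> V).
Context (sigma B eps : R) (eta : nat -> {RV P >-> R}).
Hypotheses (L_gt0 : (0 < L)%N) (N_gt0 : (0 < N)%N).
Hypotheses (u_bounded : forall y, 0 <= u y <= B) (mono_u : monotone_utility EOS u).
Hypotheses (opt_o : optimal EOS L u o) (eps_ge0 : 0 <= eps) (ssld_u : ssld EOS u o eps).
Hypotheses (ddmc_u : ddmc' EOS u) (tieP : tie_breaking tie) (noise_eta : noise T sigma eta).

Let pi := greedyETC EOS tie L N : policy R V.

Lemma independent_pair (i j : nat) (A A' : set R) : (i < T)%N -> (j < T)%N -> i != j ->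
  measurable A -> measurable A' ->
  (P ((eta i @^-1` A) `&` (eta j @^-1` A')) = P (eta i @^-1` A) * P (eta j @^-1` A'))%E%classic.
Proof.
move=> iT jT ij mA mA'; have [ind _ _] := noise_eta.
pose i' := Ordinal iT; pose j' := Ordinal jT.
pose C k := if k == i' then A else A'.
have mC k : measurable (C k) by rewrite /C; case: ifP.
have ij' : i' != j' by [].
have := ind [set i'; j']%SET C mC.
rewrite big_setU1 ?inE //= big_set1 /C eqxx [j' == i']eq_sym (negbTE ij') => <-.
congr (P _); apply/seteqP; split=> w /=.
  move=> [wA wA'] k /=; rewrite !inE => /orP[/eqP->|/eqP->].
    by rewrite eqxx.
  by rewrite eq_sym (negbTE ij').
move=> H; split.
  by have := H i'; rewrite /= eqxx; apply; rewrite !inE eqxx.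
by have := H j'; rewrite /= eq_sym (negbTE ij'); apply; rewrite !inE eqxx orbT.
Qed.

Let M k (tau : V) w := avg_noise N (fun s => eta s w) k tau.

Lemma measurable_avg_noise k tau : measurable_fun [set: Omega] (M k tau).
Proof.
by apply: measurable_funM => //; apply: measurable_sum => j; exact: measurable_funPT.
Qed.

Lemma block_lt k (j : 'I_N) (tau : V) : (L * #|V| * N <= T)%N -> (k < L)%N ->
  ((k * #|V| + index tau (enum V)) * N + j < T)%N.
Proof.
move=> LT kL; have [_ _ _ /leq_trans] := token_round EOS N_gt0 k tau (ltn_ord j).
by apply; apply: leq_trans LT; rewrite !leq_mul2r kL !orbT.
Qed.

Lemma avg_noise_bounded k tau w : (L * #|V| * N <= T)%N -> (k < L)%N ->
  `|M k tau w| <= sigma.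
Proof.
move=> LT kL; have [_ _ bnd] := noise_eta.
rewrite /M /avg_noise normrM normfV normr_nat ler_pdivrMr ?ltr0n //.
apply: le_trans (ler_norm_sum _ _ _) _.
have -> : sigma * N%:R = \sum_(j < N) sigma by rewrite sumr_const card_ord mulr_natr.
by apply: ler_sum => j _; apply: bnd; exact: block_lt.
Qed.

Lemma expectation_sqr_avg_noise k tau : (L * #|V| * N <= T)%N -> (k < L)%N ->
  ('E_P[fun w => (M k tau w ^+ 2)%R] <= (sigma ^+ 2 / N%:R)%:E)%E.
Proof.
move=> LT kL; have [_ E0 bnd] := noise_eta.
pose X (j : 'I_N) := eta ((k * #|V| + index tau (enum V)) * N + j)%N.
apply: (@expectation_sqr_mean _ _ _ _ _ X) => // [i j A A' ij mA mA'|i|i w].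
- by apply: independent_pair => //; rewrite ?block_lt // eqn_add2l.
- by apply: E0; exact: block_lt.
- by apply: bnd; exact: block_lt.
Qed.

Lemma expected_exploitation t q : 0 < q -> (L * #|V| * N <= t)%N -> (t < T)%N ->
  ((u o - (L%:R * eps + 2 * (L * #|V|)%:R * (q * sigma ^+ 2 / N%:R + q^-1)))%:E
   <= 'E_P[fun w => u (submitted pi u (fun s => eta s w) t)])%E.
Proof.
move=> q0 Lt tT; have LT : (L * #|V| * N <= T)%N := leq_trans Lt (ltnW tT).
pose S w := \sum_(p : 'I_L * V) M p.1 p.2 w ^+ 2.
pose a := u o - L%:R * eps - 2 * ((L * #|V|)%:R / q).
(* [g] is an integrable minorant of the utility: each [|M|] is replaced by [q * M ^+ 2 + q^-1], and
   the constants [q^-1] of all [L * #|V|] blocks are collected in [a]. *)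
pose g w := a - 2 * q * S w.
have iM (p : 'I_L * V) : P.-integrable [set: Omega] (EFin \o (fun w => M p.1 p.2 w ^+ 2)).
  apply: (@bounded_integrable _ _ _ _ _ (sigma ^+ 2)).
    by apply: measurable_funX; exact: measurable_avg_noise.
  move=> w; rewrite normrX lerXn2r ?nnegrE ?avg_noise_bounded //.
  exact: le_trans (normr_ge0 _) (avg_noise_bounded p.2 w LT (ltn_ord p.1)).
have iS : P.-integrable [set: Omega] (EFin \o S) by exact: integrable_fin_sum.
have LS : S \in Lfun P 1 by apply/Lfun1_integrable.
have LqS : (2 * q) \o* S \in Lfun P 1 by apply: Lfun_scale.
have La : cst a \in Lfun P 1 by apply: Lfun_cst.
have gE : g = cst a \- (2 * q) \o* S by apply/funext => w; rewrite /g /= mulrC.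
have ig : P.-integrable [set: Omega] (EFin \o g).
  by rewrite gE; apply/Lfun1_integrable; rewrite rpredB.
have Eg : ('E_P[g] = a%:E - (2 * q)%:E * 'E_P[S])%E.
  by rewrite gE expectationB // expectation_cst expectationZl.
have ES : ('E_P[S] <= ((L * #|V|)%:R * (sigma ^+ 2 / N%:R))%:E)%E.
  rewrite expectation_fin_sum //.
  apply: (@le_trans _ _ (\sum_(p : 'I_L * V) (sigma ^+ 2 / N%:R)%:E)%E).
    by apply: lee_sum => p _; exact: expectation_sqr_avg_noise.
  by rewrite sumEFin lee_fin sumr_const card_prod card_ord mulr_natl.
apply: (@le_trans _ _ 'E_P[g]%E).
  rewrite Eg; apply: (@le_trans _ _
    (a%:E - (2 * q)%:E * ((L * #|V|)%:R * (sigma ^+ 2 / N%:R))%:E)%E).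
    by rewrite -EFinM -EFinB lee_fin /a; lra.
  by apply: leeB => //; apply: lee_wpmul2l => //; rewrite lee_fin; lra.
(* The utility of the submitted sequence enters only through its nonnegativity and the pointwise
   bound by [g]. *)
rewrite unlock; apply: le_integral_ge0 => // w; rewrite lee_fin.
  by case/andP: (u_bounded (submitted pi u (fun s => eta s w) t)).
apply: le_trans (exploitation_bound (fun s => eta s w) N_gt0 L_gt0 Lt mono_u opt_o
  eps_ge0 ssld_u ddmc_u tieP).
rewrite pair_bigA /=.
(* After multiplication by [q] this is [z <= z ^+ 2 + 1] for [z = q * |M|]. *)
have step (p : 'I_L * V) : `|M p.1 p.2 w| <= q * M p.1 p.2 w ^+ 2 + q^-1.
  rewrite -(real_normK (num_real (M p.1 p.2 w))).
  rewrite -(ler_pM2l q0) mulrDr divff ?gt_eqF // mulrA -expr2 -exprMn.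
  have : 0 <= q * `|M p.1 p.2 w| by rewrite mulr_ge0 // ltW.
  by have := sqr_ge0 (q * `|M p.1 p.2 w| - 1); move: (q * _) => z; nra.
have := ler_sum (index_enum _) (fun p (_ : true) => step p).
rewrite big_split /= sumr_const card_prod card_ord -mulr_sumr -/(S w).
rewrite /g /a -(mulr_natl q^-1) -/(M _ _ w).
set X := \sum_i _; set Y := (_ * _)%:R * q^-1; lra.
Qed.

Lemma max_utility_le : max_utility EOS L u <= u o.
Proof.
have [_ _ ou] := opt_o; apply/bigmax_leP; split=> [|z cz].
  by case/andP: (u_bounded o).
by apply: ou => //; exact: size_bseq.
Qed.

Lemma regret_bound q : 0 < q ->
  (regret EOS T L u eta pi <=
    ((L * #|V| * N)%:R * B + T%:R * (L%:R * eps
       + 2 * (L * #|V|)%:R * (q * sigma ^+ 2 / N%:R + q^-1)))%:E)%E.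
Proof.
move=> q0; set D := L%:R * eps + _; set m := (L * #|V| * N)%N.
have D0 : 0 <= D.
  have ? : 0 <= L%:R :> R := ler0n _ _.
  have ? : 0 <= (L * #|V|)%:R :> R := ler0n _ _.
  have ? : 0 <= q^-1 by rewrite invr_ge0 ltW.
  have ? : 0 <= q * sigma ^+ 2 / N%:R.
    by apply: mulr_ge0; rewrite ?invr_ge0 ?ler0n //; apply: mulr_ge0; rewrite ?sqr_ge0 // ltW.
  apply: addr_ge0; first exact: mulr_ge0.
  apply: mulr_ge0; last exact: addr_ge0.
  by rewrite mulr_ge0 ?ler0n.
have B0 : 0 <= B by case/andP: (u_bounded o) => /le_trans; apply.
have uB : u o <= B by case/andP: (u_bounded o).
(* An exploration round is charged [B], which makes its lower bound nonpositive and so trivial. *)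
pose b t : R := if (t < m)%N then B else 0.
have Et (t : 'I_T) : ((u o - b t - D)%:E
    <= 'E_P[fun w => u (submitted pi u (fun s => eta s w) t)])%E.
  rewrite /b; case: ltnP => tm.
    apply: (@le_trans _ _ 0%E); first by rewrite lee_fin; lra.
    by apply: expectation_ge0 => w; case/andP: (u_bounded (submitted pi u (eta ^~ w) t)).
  by rewrite subr0; apply: expected_exploitation.
have sumb : \sum_(t < T) b t <= m%:R * B.
  (* The minimum also covers a horizon that ends during exploration. *)
  suff H K : \sum_(t < K) b t <= (minn K m)%:R * B.
    by apply: le_trans (H T) _; rewrite ler_wpM2r // ler_nat geq_minr.
  elim: K => [|K IH]; first by rewrite big_ord0 min0n mul0r.
  rewrite big_ord_recr /= /b; have [Km|mK] := ltnP K m.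
    by move: IH; rewrite (minn_idPl (ltnW Km)) (minn_idPl Km) -natr1 mulrDl mul1r lerD2r.
  by move: IH; rewrite addr0 (minn_idPr mK) (minn_idPr (leqW mK)).
apply: (@le_trans _ _ ((T%:R * u o)%:E - \sum_(t < T) (u o - b t - D)%:E)%E).
  apply: leeB; last by apply: lee_sum => t _; exact: Et.
  by rewrite lee_fin ler_wpM2l // max_utility_le.
rewrite sumEFin -EFinB lee_fin !sumrB !sumr_const card_ord -(mulr_natl (u o)) -(mulr_natl D).
by rewrite -/m; lra.
Qed.

End Regret.

(** * Powers and logarithms of the horizon *)

Section Rate.
Context (R : realType) (T : nat).
Hypothesis T_ge2 : (2 <= T)%N.

Let q : R := T%:R `^ 3^-1.

Lemma cube_root_ge1 : 1 <= q.
Proof.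
have T1 : 1 <= T%:R :> R by rewrite ler1n ltnW.
by rewrite -[leLHS](powRr0 T%:R) ler_powR.
Qed.

Lemma cube_rootK : q ^+ 3 = T%:R.
Proof.
by rewrite -powR_mulrn ?powR_ge0 // -powRrM mulVf ?pnatr_eq0 // powRr1.
Qed.

Lemma cube_root_sqr : T%:R `^ (2 / 3) = q ^+ 2.
Proof. by rewrite -powR_mulrn ?powR_ge0 // -powRrM mulrC. Qed.

Lemma sqrt_le_cube_root_sqr : T%:R / Num.sqrt T%:R <= q ^+ 2.
Proof.
have q1 := cube_root_ge1; have T0 : 0 < T%:R :> R by rewrite ltr0n ltnW.
have -> : T%:R / Num.sqrt T%:R = Num.sqrt T%:R :> R.
  by rewrite -{1}(sqr_sqrtr (ltW T0)) expr2 mulfK // gt_eqF ?sqrtr_gt0.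
(* Squaring reduces the claim to [q ^+ 3 <= q ^+ 4]. *)
rewrite -(@ler_pXn2r _ 2) ?nnegrE ?sqrtr_ge0 ?sqr_ge0 //.
by rewrite (sqr_sqrtr (ltW T0)) -cube_rootK -exprM ler_weXn2l.
Qed.

Lemma block_length_bounds :
  let N := (Num.trunc (T%:R `^ (2 / 3) : R)).+1 in
  q ^+ 2 <= N%:R /\ N%:R <= 2 * q ^+ 2.
Proof.
rewrite cube_root_sqr /=.
have /andP[lo hi] := truncn_itv (sqr_ge0 q).
have : 1 <= q ^+ 2 by rewrite exprn_ege1 // cube_root_ge1.
by split; [exact: ltW|rewrite -natr1; lra].
Qed.

Lemma log_factor_bound (x : R) : 0 <= x ->
  x <= x / ln 2 `^ (1 / 3) * ln T%:R `^ (1 / 3).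
Proof.
move=> x0; have l2 : 0 < ln 2 :> R by rewrite ln_gt0 // ltr1n.
have p2 : 0 < ln 2 `^ (1 / 3) :> R by rewrite powR_gt0.
rewrite mulrAC ler_pdivlMr // ler_wpM2l //.
have l2T : ln 2 <= ln T%:R :> R by rewrite ler_ln ?posrE ?ltr0n ?ler_nat // ltnW.
apply: ge0_ler_powR => //; rewrite ?nnegrE ?ltW //.
exact: lt_le_trans l2T.
Qed.

End Rate.

(** * Choice of the block length and of the constant *)

Theorem theorem4p2 (R : realType) (sigma B c : R) :
  exists (C : R) (N : nat -> nat -> nat -> nat),
    (forall T n L, (0 < N T n L)%N) /\
    forall (T n L : nat) (V : finType) (EOS : V) (u : seq V -> R) (o : seq V)
      (tie : seq V -> {set V} -> V)
      (d : measure_display) (Omega : measurableType d) (P : probability Omega R)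
      (eta : nat -> {RV P >-> R}),
      (2 <= T)%N -> (1 <= L)%N -> #|V| = n ->
      (forall y, 0 <= u y <= B) ->
      monotone_utility EOS u ->
      optimal EOS L u o ->
      ssld EOS u o (c / Num.sqrt T%:R) ->
      ddmc' EOS u ->
      tie_breaking tie ->
      noise T sigma eta ->
      (regret EOS T L u eta (greedyETC EOS tie L (N T n L))
        <= (C * n%:R * L%:R * (T%:R `^ (2 / 3)) * (ln T%:R `^ (1 / 3)))%:E)%E.
Proof.
(* The three summands pay for [exploration], [deviation] and [estimation] below, each in units of
   [n * L * q ^+ 2]. *)
pose K := 2 * `|B| + `|c| + 2 * (sigma ^+ 2 + 1).
exists (K / ln 2 `^ (1 / 3)), (fun T _ _ => (Num.trunc (T%:R `^ (2 / 3) : R)).+1).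
split=> // T n L V EOS u o tie d Omega P eta T2 L1 Vn uB mono opt ssld_o ddmc tieP noise_eta.
set N := (Num.trunc _).+1; set q : R := T%:R `^ 3^-1.
have q1 : 1 <= q by exact: cube_root_ge1.
have q0 : 0 < q by lra.
have [qN N2] : q ^+ 2 <= N%:R /\ N%:R <= 2 * q ^+ 2 by exact: block_length_bounds.
(* The sign of [c] is arbitrary, while [regret_bound] asks for a nonnegative deviation. *)
pose eps := `|c| / Num.sqrt T%:R.
have eps0 : 0 <= eps by rewrite divr_ge0 ?sqrtr_ge0.
have ssld_eps : ssld EOS u o eps.
  move=> a i /ssld_o /le_trans; apply.
  by rewrite ler_wpM2r ?invr_ge0 ?sqrtr_ge0 ?ler_norm.
have := regret_bound L1 (isT : (0 < N)%N) uB mono opt eps0 ssld_eps ddmc tieP noise_eta q0.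
move/le_trans; apply; rewrite lee_fin Vn.
have K0 : 0 <= K by rewrite /K; have := normr_ge0 B; have := normr_ge0 c; nra.
have n1 : (0 < n)%N by rewrite -Vn (card_token_gt0 EOS).
apply: (@le_trans _ _ (K * (n%:R * L%:R * q ^+ 2))); last first.
  have x0 : 0 <= K * (n%:R * L%:R * q ^+ 2).
    by apply: mulr_ge0 => //; apply: mulr_ge0; rewrite ?sqr_ge0 //; exact: mulr_ge0.
  apply: le_trans (log_factor_bound T2 x0) _.
  by rewrite (cube_root_sqr R T) -/q le_eqVlt; apply/orP; left; apply/eqP; ring.
have exploration : (L * n * N)%:R * B <= 2 * `|B| * (n%:R * L%:R * q ^+ 2).
  apply: (@le_trans _ _ ((L * n * N)%:R * `|B|)).
    by rewrite ler_wpM2l ?ler_norm.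
  have -> : 2 * `|B| * (n%:R * L%:R * q ^+ 2) = L%:R * n%:R * (2 * q ^+ 2) * `|B| by ring.
  by rewrite !natrM ler_wpM2r // ler_wpM2l ?mulr_ge0.
have deviation : T%:R * (L%:R * eps) <= `|c| * (n%:R * L%:R * q ^+ 2).
  have -> : T%:R * (L%:R * eps) = `|c| * (L%:R * (T%:R / Num.sqrt T%:R)) by rewrite /eps; ring.
  apply: ler_wpM2l => //; rewrite [n%:R * _]mulrC -mulrA; apply: ler_wpM2l => //.
  apply: le_trans (sqrt_le_cube_root_sqr R T2) _.
  by rewrite ler_peMl ?sqr_ge0 // ler1n.
(* Since [q ^+ 2 <= N], the bracket is at most [(sigma ^+ 2 + 1) / q], and [T / q = q ^+ 2]. *)
have estimation : T%:R * (2 * (L * n)%:R * (q * sigma ^+ 2 / N%:R + q^-1))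
    <= 2 * (sigma ^+ 2 + 1) * (n%:R * L%:R * q ^+ 2).
  have N0 : 0 < N%:R :> R by rewrite ltr0n.
  have -> : 2 * (sigma ^+ 2 + 1) * (n%:R * L%:R * q ^+ 2) =
      T%:R * (2 * (L * n)%:R * ((sigma ^+ 2 + 1) / q)).
    by rewrite -(cube_rootK R T) -/q natrM; field; rewrite gt_eqF.
  rewrite ler_wpM2l // ler_wpM2l ?mulr_ge0 // mulrDl div1r lerD2r.
  rewrite ler_pdivrMr // mulrAC ler_pdivlMr //.
  have -> : q * sigma ^+ 2 * q = sigma ^+ 2 * q ^+ 2 by ring.
  by rewrite ler_wpM2l ?sqr_ge0.
by rewrite [T%:R * (_ + _)]mulrDr /K; lra.
Qed.
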